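(* On the space $\mathbb G_3$ of oriented geodesics of $\mathbb H^3$, $$\mathbf g=\mathrm{Re}\big(\langle\cdot,\cdot\rangle_{\mathbb G}\big).$$
   Context: $\mathbb H^3=\{x\in\mathbb R^{3,1}\mid\langle x,x\rangle=-1,\ x_4>0\}$ with $\langle x,y\rangle=x_1y_1+x_2y_2+x_3y_3-x_4y_4$; $T^1\mathbb H^3=\{(x,v)\mid x\in\mathbb H^3,\ \langle x,v\rangle=0,\ \langle v,v\rangle=1\}$. $\mathbb G_3$ is the manifold of oriented maximal unparametrized geodesics of $\mathbb H^3$ and $\mathrm p\colon T^1\mathbb H^3\to\mathbb G_3$ sends $(x,v)$ to the oriented geodesic through $x$ tangent to $v$. For $w\in T_x\mathbb H^3$ with $\langle w,v\rangle=0$, let $w^{\mathcal H}=(w,0)$ and $w^{\mathcal V}=(0,w)$ in $T_{(x,v)}T^1\mathbb H^3\subset\mathbb R^{3,1}\times\mathbb R^{3,1}$. $d\mathrm p$ restricts to an isomorphism from the span of these vectors onto $T_{\mathrm p(x,v)}\mathbb G_3$, and the pseudo-Riemannian metric $\mathbf g$ is (well) defined by $\mathbf g(d\mathrm p(w_1^{\mathcal H}+u_1^{\mathcal V}),d\mathrm p(w_2^{\mathcal H}+u_2^{\mathcal V}))=\langle w_1,w_2\rangle-\langle u_1,u_2\rangle$. On the other hand, identify $\partial\mathbb H^3$ with $\mathbb{CP}^1$ (so that $\mathrm{Isom}_0(\mathbb H^3)\cong PSL(2,\mathbb C)$ acts by Möbius transformations) and $\mathbb G_3$ with $\mathbb{CP}^1\times\mathbb{CP}^1\setminus\Delta$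 by taking the (final, initial) endpoints at infinity of an oriented geodesic. $\langle\cdot,\cdot\rangle_{\mathbb G}$ is the holomorphic Riemannian ($\mathbb C$-bilinear) metric on $\mathbb{CP}^1\times\mathbb{CP}^1\setminus\Delta$ given, for every affine chart $(U,z)$ of $\mathbb{CP}^1$, in the chart $(U\times U\setminus\Delta,z\times z)$ by $-\frac{4}{(z_1-z_2)^2}dz_1\cdot dz_2$, where $dz_1\cdot dz_2=\frac12(dz_1\otimes dz_2+dz_2\otimes dz_1)$; it is independent of the chart and is the unique $PSL(2,\mathbb C)$-invariant holomorphic Riemannian metric of constant curvature $-1$. *)

(* Defs.v *)
(* Stdlib reals with Coquelicot (limits, derivatives, complex numbers). *)
From Stdlib Require Import Reals Lra ClassicalEpsilon.
From Coquelicot Require Import Coquelicot.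
Open Scope R_scope.

(* As a Coquelicot normed module, this iterated product carries the usual
   topology and linear structure of R^4. *)
Definition R31 : Type := (R * R * R * R)%type.

Definition mink (x y : R31) : R :=
  let '(x1, x2, x3, x4) := x in
  let '(y1, y2, y3, y4) := y in
  x1 * y1 + x2 * y2 + x3 * y3 - x4 * y4.

Definition time (x : R31) : R := snd x.

Definition in_H3 (x : R31) : Prop := mink x x = -1 /\ 0 < time x.

Definition T1H3 : Type :=
  { q : R31 * R31 |
    in_H3 (fst q) /\ mink (fst q) (snd q) = 0 /\ mink (snd q) (snd q) = 1 }.

Definition basept (q : T1H3) : R31 := fst (proj1_sig q).
Definition direction (q : T1H3) : R31 := snd (proj1_sig q).

(* The maximal unit-speed geodesic with initial data q: its acceleration in
   R^{3,1} is geodesic q t itself, which is normal to H^3. *)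
Definition geodesic (q : T1H3) (t : R) : R31 :=
  plus (scal (cosh t) (basept q)) (scal (sinh t) (direction q)).

Definition geodesic_velocity (q : T1H3) (t : R) : R31 :=
  plus (scal (sinh t) (basept q)) (scal (cosh t) (direction q)).

(* An oriented maximal unparametrized geodesic is represented by the set of its
   positively oriented unit tangent vectors, i.e. by its lift to T^1 H^3. *)
Definition G3 : Type :=
  { l : R31 * R31 -> Prop |
    exists q : T1H3,
      l = (fun r => exists t, r = (geodesic q t, geodesic_velocity q t)) }.

Definition pG (q : T1H3) : G3 :=
  exist _ (fun r => exists t, r = (geodesic q t, geodesic_velocity q t))
        (ex_intro _ q eq_refl).

(* A null line of R^{3,1} is represented by its point with x_4 = 1; this is the
   sphere at infinity of the projective (Klein) model of H^3. *)
Definition bdH3 : Type := { n : R31 | mink n n = 0 /\ time n = 1 }.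

Lemma bdH3_inhabited : inhabited bdH3.
Proof.
  apply inhabits; exists (0, 0, 1, 1); unfold mink, time; simpl; split; ring.
Qed.

Definition klein (x : R31) : R31 := scal (/ time x) x.

(* The endpoint as t -> s, where s is p_infty (final) or m_infty (initial). *)
Definition endpoint (s : Rbar) (l : G3) : bdH3 :=
  epsilon bdH3_inhabited (fun n =>
    forall q : T1H3, pG q = l ->
      filterlim (fun t => klein (geodesic q t)) (Rbar_locally s)
                (locally (proj1_sig n))).

(* CP^1 as C with a point at infinity: CFin z is [z : 1] and CInf is [1 : 0]. *)
Inductive CP1 : Type := CFin (z : C) | CInf.

Definition homog (P : CP1) : C * C :=
  match P with
  | CFin z => (z, RtoC 1)
  | CInf => (RtoC 1, RtoC 0)
  end.

(* The point [u : v] of CP^1, for (u, v) <> (0, 0). *)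
Definition of_homog (u v : C) : CP1 :=
  if Ceq_dec v 0 then CInf else CFin (u / v)%C.

Record M2C : Type := mkM2C { m11 : C; m12 : C; m21 : C; m22 : C }.

Definition det2 (A : M2C) : C := (m11 A * m22 A - m12 A * m21 A)%C.

Definition mul2 (A B : M2C) : M2C :=
  mkM2C (m11 A * m11 B + m12 A * m21 B)%C (m11 A * m12 B + m12 A * m22 B)%C
        (m21 A * m11 B + m22 A * m21 B)%C (m21 A * m12 B + m22 A * m22 B)%C.

Definition adj2 (A : M2C) : M2C :=
  mkM2C (Cconj (m11 A)) (Cconj (m21 A)) (Cconj (m12 A)) (Cconj (m22 A)).

Definition mobius (A : M2C) (P : CP1) : CP1 :=
  let '(u, v) := homog P in
  of_homog (m11 A * u + m12 A * v)%C (m21 A * u + m22 A * v)%C.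

(* Stereographic projection from the null line of (0, 0, 1, 1). *)
Definition bd_to_CP1 (n : bdH3) : CP1 :=
  let '(n1, n2, n3, _) := proj1_sig n in
  if Req_dec_T n3 1 then CInf else CFin ((n1, n2) / RtoC (1 - n3))%C.

(* The usual identification of R^{3,1} with Hermitian matrices, for which
   det (herm x) = - mink x x and SL(2, C) acts by isometries through
   X |-> A X A^*. *)
Definition herm (x : R31) : M2C :=
  let '(x1, x2, x3, x4) := x in
  mkM2C (RtoC (x4 + x3)) (x1, x2) (x1, - x2) (RtoC (x4 - x3)).

Lemma det_herm (x : R31) : det2 (herm x) = RtoC (- mink x x).
Proof.
  destruct x as [[[x1 x2] x3] x4]; unfold det2, mink; simpl.
  apply injective_projections; simpl; ring.
Qed.

Lemma herm_null_fin (n1 n2 n3 : R) :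
  n1 * n1 + n2 * n2 + n3 * n3 - 1 * 1 = 0 -> n3 <> 1 ->
  let z := ((n1, n2) / RtoC (1 - n3))%C in
  let s := RtoC (1 - n3) in
  herm (n1, n2, n3, 1) =
  mkM2C (s * (z * Cconj z))%C (s * z)%C (s * Cconj z)%C s.
Proof.
  intros H H3 z s; unfold z, s; simpl.
  assert (H1 : 1 - n3 <> 0) by lra.
  assert (Hp : 1 + n3 = (n1 * n1 + n2 * n2) / (1 - n3))
    by (apply (Rmult_eq_reg_r (1 - n3)); [ field_simplify; [ nra | lra ] | lra ]).
  f_equal; apply injective_projections; simpl; try (field; lra); try ring.
  rewrite Hp; field; lra.
Qed.

Lemma Cmult_conj_pos (v : C) : v <> 0 -> (v * Cconj v)%C <> 0.
Proof.
  intros Hv; apply Cmult_neq_0; [ exact Hv | ].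
  intros H; apply Hv; rewrite <- (Cconj_conj v), H.
  apply injective_projections; simpl; ring.
Qed.

Lemma Cconj_0 : Cconj 0 = 0.
Proof. apply injective_projections; simpl; ring. Qed.

(* The point of CP^1 attached to a null line whose Hermitian matrix is a real
   multiple of xi xi^*, with xi = (u, v). *)
Lemma bd_to_CP1_rank1 (n : bdH3) (k s : R) (u v : C) :
  s <> 0 -> (u <> 0 \/ v <> 0) ->
  herm (scal k (proj1_sig n)) =
  mkM2C (s * (u * Cconj u))%C (s * (u * Cconj v))%C
        (s * (v * Cconj u))%C (s * (v * Cconj v))%C ->
  bd_to_CP1 n = of_homog u v.
Proof.
  destruct n as [[[[n1 n2] n3] n4] [Hn H4]]; simpl in *; subst n4.
  unfold scal; simpl; unfold mult; simpl.
  intros Hs Huv E.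
  pose proof (f_equal m11 E) as E11; pose proof (f_equal m12 E) as E12.
  pose proof (f_equal m22 E) as E22; cbn [m11 m12 m22] in E11, E12, E22.
  assert (Hs' : RtoC s <> 0) by (intros h; apply Hs; now injection h).
  set (q := (n1, n2) : C).
  assert (F11 : (RtoC k * RtoC (1 + n3) = s * (u * Cconj u))%C)
    by (rewrite <- E11; apply injective_projections; simpl; ring).
  assert (F12 : (RtoC k * q = s * (u * Cconj v))%C)
    by (rewrite <- E12; apply injective_projections; simpl; ring).
  assert (F22 : (RtoC k * RtoC (1 - n3) = s * (v * Cconj v))%C)
    by (rewrite <- E22; apply injective_projections; simpl; ring).
  clear E E11 E12 E22; unfold bd_to_CP1, of_homog; simpl.
  destruct (Req_dec_T n3 1) as [H3 | H3]; destruct (Ceq_dec v 0) as [Hv | Hv];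
    [ reflexivity | exfalso | exfalso | f_equal ].
  - apply (Cmult_neq_0 _ _ Hs' (Cmult_conj_pos v Hv)).
    rewrite <- F22, H3; apply injective_projections; simpl; ring.
  - assert (Hu : u <> 0) by tauto.
    apply (Cmult_neq_0 _ _ Hs' (Cmult_conj_pos u Hu)).
    assert (Hk : RtoC k = 0).
    { destruct (Ceq_dec k 0) as [h | h]; [ exact h | exfalso ].
      assert (H1 : RtoC (1 - n3) <> 0)
        by (intros h1; apply H3; injection h1; lra).
      apply (Cmult_neq_0 _ _ h H1); rewrite F22, Hv; ring. }
    rewrite <- F11, Hk; ring.
  - assert (H1 : RtoC (1 - n3) <> 0)
      by (intros h1; apply H3; injection h1; lra).
    pose proof (Cmult_neq_0 _ _ Hs' (Cmult_conj_pos v Hv)) as Hvv.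
    assert (Hk : RtoC k <> 0)
      by (intros h; apply Hvv; rewrite <- F22, h; ring).
    assert (Hcv : Cconj v <> 0)
      by (intros h; apply Hvv; rewrite h; ring).
    fold q.
    replace (q / RtoC (1 - n3))%C
      with ((RtoC k * q) / (RtoC k * RtoC (1 - n3)))%C by (field; auto).
    rewrite F12, F22; field; auto.
Qed.

(* The identification of the boundary with CP^1 turns the action of the
   isometries X |-> A X A^* into the action by Mobius transformations. *)
Lemma bd_to_CP1_equivariant (A : M2C) (n n' : bdH3) (k : R) :
  det2 A <> 0 ->
  herm (scal k (proj1_sig n')) =
  mul2 A (mul2 (herm (proj1_sig n)) (adj2 A)) ->
  bd_to_CP1 n' = mobius A (bd_to_CP1 n).
Proof.
  intros HA E.
  assert (Hdet : forall u v : C, (u <> 0 \/ v <> 0) ->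
    (m11 A * u + m12 A * v)%C <> 0 \/ (m21 A * u + m22 A * v)%C <> 0).
  { intros u v Huv.
    destruct (Ceq_dec (m11 A * u + m12 A * v)%C 0) as [h1 | h1]; [ | now left ].
    destruct (Ceq_dec (m21 A * u + m22 A * v)%C 0) as [h2 | h2]; [ | now right ].
    exfalso; destruct Huv as [h | h]; apply (Cmult_neq_0 _ _ HA h); unfold det2.
    - replace ((m11 A * m22 A - m12 A * m21 A) * u)%C
        with (m22 A * (m11 A * u + m12 A * v) - m12 A * (m21 A * u + m22 A * v))%C
        by ring.
      rewrite h1, h2; ring.
    - replace ((m11 A * m22 A - m12 A * m21 A) * v)%C
        with (m11 A * (m21 A * u + m22 A * v) - m21 A * (m11 A * u + m12 A * v))%C
        by ring.
      rewrite h1, h2; ring. }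
  destruct n as [[[[n1 n2] n3] n4] [Hn H4]]; simpl proj1_sig in *.
  unfold time in H4; simpl in H4; subst n4; unfold mink in Hn.
  unfold bd_to_CP1 at 2; cbn [proj1_sig]; cbv beta iota.
  destruct (Req_dec_T n3 1) as [H3 | H3].
  - subst n3; unfold mobius; simpl.
    assert (n1 = 0 /\ n2 = 0) as [-> ->] by (split; nra).
    apply (bd_to_CP1_rank1 n' k 2).
    + lra.
    + apply Hdet; left; intros h; injection h; lra.
    + rewrite E; unfold mul2; simpl.
      f_equal; apply injective_projections; simpl; ring.
  - unfold mobius; simpl.
    apply (bd_to_CP1_rank1 n' k (1 - n3)).
    + lra.
    + apply Hdet; right; intros h; injection h; lra.
    + rewrite E, (herm_null_fin _ _ _ Hn H3).
      set (z := ((n1, n2) / RtoC (1 - n3))%C); clearbody z; unfold mul2; simpl.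
      f_equal; apply injective_projections; simpl; ring.
Qed.

(* An affine chart (U, z) of CP^1 is given by A in GL(2, C): z is the Mobius
   transformation of A followed by the standard coordinate, and U is the
   complement of its pole. *)
Definition chart_dom (A : M2C) (P : CP1) : Prop := mobius A P <> CInf.

Definition chart (A : M2C) (P : CP1) : C :=
  match mobius A P with CFin z => z | CInf => RtoC 0 end.

Definition final_pt (l : G3) : CP1 := bd_to_CP1 (endpoint p_infty l).
Definition initial_pt (l : G3) : CP1 := bd_to_CP1 (endpoint m_infty l).

(* The chart (U x U \ Delta, z x z), read on G_3. *)
Definition chartG_dom (A : M2C) (l : G3) : Prop :=
  chart_dom A (final_pt l) /\ chart_dom A (initial_pt l).

Definition chartG (A : M2C) (l : G3) : C * C :=
  (chart A (final_pt l), chart A (initial_pt l)).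

(* Z is the expression, in the chart of A, of the image under d pG at q of the
   tangent vector W, defined through curves of T^1 H^3 with velocity W. *)
Definition is_dpG (A : M2C) (q : T1H3) (W : R31 * R31) (Z : C * C) : Prop :=
  forall c : R -> T1H3,
    c 0 = q ->
    is_derive (fun t => proj1_sig (c t)) 0 W ->
    is_derive (fun t => chartG A (pG (c t))) 0 Z.

Definition normal_to (q : T1H3) (w : R31) : Prop :=
  mink w (basept q) = 0 /\ mink w (direction q) = 0.

(* w^H + u^V *)
Definition lift (w u : R31) : R31 * R31 := (w, u).

(* The metric g at l, evaluated on the tangent vectors of G_3 with expressions
   Z1 and Z2 in the chart of A. *)
Definition g_metric (A : M2C) (l : G3) (Z1 Z2 : C * C) : R :=
  epsilon (inhabits 0) (fun r =>
    exists (q : T1H3) (w1 u1 w2 u2 : R31),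
      pG q = l /\
      normal_to q w1 /\ normal_to q u1 /\ normal_to q w2 /\ normal_to q u2 /\
      is_dpG A q (lift w1 u1) Z1 /\ is_dpG A q (lift w2 u2) Z2 /\
      r = mink w1 w2 - mink u1 u2).

(* The symmetric product dz_1 . dz_2 evaluated on two vectors of C^2. *)
Definition dz1dz2 (Z1 Z2 : C * C) : C :=
  (/ 2 * (fst Z1 * snd Z2 + snd Z1 * fst Z2))%C.

Definition hol_metric (z Z1 Z2 : C * C) : C :=
  (- (4 / ((fst z - snd z) * (fst z - snd z))) * dz1dz2 Z1 Z2)%C.

(* Main.v *)
Require Import Defs.
From Stdlib Require Import Reals Lra ClassicalEpsilon.
From Coquelicot Require Import Coquelicot.

(** Write an oriented geodesic through (x, v) as the pair of null vectors
    p = x + v and m = x - v, which span its endpoints at infinity.  The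
    horizontal-vertical splitting turns into P = w + u (the velocity of p) and
    M = w - u (the velocity of m), both orthogonal to p and m, and polarizing
    <w, w> - <u, u> = <P, M> shows that g pairs the velocity of one endpoint
    with that of the other, exactly as dz1 . dz2 does.  It remains to compare
    two bilinear pairings of P with M.

    The chart attached to A in GL(2, C) is handled by the linear action
    [act A] of A on R^{3,1}: it scales [mink] by |det A|^2, and the chart
    composed with the endpoint map is [stereo] of [act A (x + v)] and of
    [act A (x - v)] ([chart_endpoint]).  A null vector with stereographic
    coordinate z is a multiple of
      c(z) = (2 Re z, 2 Im z, |z|^2 - 1, |z|^2 + 1),
    and <c(z), c(w)> = - 2 |z - w|^2.  Differentiating this formula in z, in w
    and in both gives all the products needed for [Re_stereo_metric]:
      Re (4 dz(P) dw(M) / (z - w)^2) = 2 <P, M> / <p, m>.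
    The right side is unchanged when <,> is rescaled, so the factor |det A|^2
    disappears; with <p, m> = - 2 this is the claimed equality.

    The metric g is given by a choice operator and the differential of the
    projection by a quantifier over curves, so two facts have to be supplied
    besides the computation: every normal pair (w, u) is the velocity of a
    curve, so the differential takes only the computed value ([is_dpG_iff]);
    and the differential is onto ([dchartG_surj]), so the condition defining
    g is satisfiable.  The endpoints themselves are found from
      cosh t x + sinh t v = e^t / 2 (p + e^{-2t} m). *)

Set Bullet Behavior "Strict Subproofs".

(** * Linear algebra of Minkowski space *)

(** [R31] is a bare product of sets of reals; continuity and derivatives of maps
    into it refer to this normed module. *)
Local Notation R31_module :=
  (prod_NormedModule R_AbsRing
    (prod_NormedModule R_AbsRing
      (prod_NormedModule R_AbsRing R_NormedModule R_NormedModule) R_NormedModule)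
    R_NormedModule).

Ltac coords := repeat match goal with x : R31 |- _ => destruct x as [[[? ?] ?] ?] end.
Ltac vec_unfold := unfold minus, plus, opp, scal;
  repeat (cbn; unfold plus, scal, opp, mult).
Ltac vec_field := repeat apply injective_projections; cbn; field.

Lemma mink_sym x y : mink x y = mink y x.
Proof. coords; unfold mink; ring. Qed.

Lemma mink_plus_r (x y z : R31) : mink x (plus y z) = mink x y + mink x z.
Proof. coords; unfold mink; vec_unfold; ring. Qed.

Lemma mink_scal_r (x y : R31) (k : R) : mink x (scal k y) = k * mink x y.
Proof. coords; unfold mink; vec_unfold; ring. Qed.

Lemma mink_plus_l (x y z : R31) : mink (plus y z) x = mink y x + mink z x.
Proof. coords; unfold mink; vec_unfold; ring. Qed.

Lemma mink_scal_l (x y : R31) (k : R) : mink (scal k y) x = k * mink y x.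
Proof. coords; unfold mink; vec_unfold; ring. Qed.

(** Continuity is automatic in finite dimension: the map is the combination of
    the images of the basis vectors whose coefficients are the coordinates. *)
Lemma is_linear_R31 {V : NormedModule R_AbsRing} (f : R31 -> V) :
  (forall x y : R31, f (plus x y) = plus (f x) (f y)) ->
  (forall (k : R) (x : R31), f (scal k x) = scal k (f x)) -> is_linear f.
Proof.
  intros Hp Hs.
  apply (is_linear_ext (fun x : R31 =>
    plus (plus (plus (scal (fst (fst (fst x))) (f (1, 0, 0, 0)))
                     (scal (snd (fst (fst x))) (f (0, 1, 0, 0))))
               (scal (snd (fst x)) (f (0, 0, 1, 0))))
         (scal (snd x) (f (0, 0, 0, 1))))).
  - intros x; rewrite <- !Hs, <- !Hp; f_equal; coords.
    vec_unfold; vec_field.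
  - assert (Hplus : forall g h : R31 -> V, is_linear g -> is_linear h ->
              is_linear (fun x => plus (g x) (h x))).
    { intros g h Hg Hh.
      apply (is_linear_comp (fun x => (g x, h x)) (fun p => plus (fst p) (snd p))).
      - now apply is_linear_prod.
      - apply is_linear_plus. }
    assert (Hscal : forall (g : R31 -> R) (v : V), is_linear g ->
              is_linear (fun x : R31 => scal (g x) v)).
    { intros g v Hg; apply (is_linear_comp g (fun k : R_NormedModule => scal k v)); [ exact Hg | ].
      exact (is_linear_scal_l (K := R_AbsRing) v). }
    repeat apply Hplus; apply Hscal.
    + exact (is_linear_comp fst (fun y => fst (fst y)) is_linear_fst
               (is_linear_comp fst fst is_linear_fst is_linear_fst)).
    + exact (is_linear_comp fst (fun y => snd (fst y)) is_linear_fst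
               (is_linear_comp fst snd is_linear_fst is_linear_snd)).
    + exact (is_linear_comp fst snd is_linear_fst is_linear_snd).
    + exact is_linear_snd.
Qed.

(** * The action of GL(2, C) on Hermitian matrices *)

Definition unherm (M : M2C) : R31 :=
  (Re (m12 M), Im (m12 M), (Re (m11 M) - Re (m22 M)) / 2, (Re (m11 M) + Re (m22 M)) / 2).

(** The action X |-> A X A^* of A on Hermitian matrices, read on R^{3,1}.  It
    covers the Mobius transformation of A on the null lines. *)
Definition act (A : M2C) (x : R31) : R31 := unherm (mul2 A (mul2 (herm x) (adj2 A))).

Definition Cnorm2 (z : C) : R := fst z * fst z + snd z * snd z.

Ltac act_unfold := unfold act, unherm, mul2, adj2, det2, Cnorm2, Re, Im.

Lemma herm_act A x : herm (act A x) = mul2 A (mul2 (herm x) (adj2 A)).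
Proof.
  destruct A as [[a a'] [b b'] [c c'] [d d']]; coords.
  act_unfold; simpl.
  f_equal; apply injective_projections; simpl; field.
Qed.

(** The quadratic form is minus the determinant of the Hermitian matrix, so this
    is the polarization of det (A X A^* ) = |det A|^2 det X. *)
Lemma mink_act A x y : mink (act A x) (act A y) = Cnorm2 (det2 A) * mink x y.
Proof.
  destruct A as [[a a'] [b b'] [c c'] [d d']]; coords.
  act_unfold; unfold mink; simpl; field.
Qed.

Lemma act_plus A (x y : R31) : act A (plus x y) = plus (act A x) (act A y).
Proof.
  destruct A as [[a a'] [b b'] [c c'] [d d']]; coords.
  act_unfold; vec_unfold; vec_field.
Qed.

Lemma act_scal A (k : R) (y : R31) : act A (scal k y) = scal k (act A y).
Proof.
  destruct A as [[a a'] [b b'] [c c'] [d d']]; coords.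
  act_unfold; vec_unfold; vec_field.
Qed.

Definition adjugate A := mkM2C (m22 A) (- m12 A)%C (- m21 A)%C (m11 A).

Lemma mul2_assoc A B D : mul2 A (mul2 B D) = mul2 (mul2 A B) D.
Proof. unfold mul2; cbn; f_equal; ring. Qed.

Lemma adj2_mul2 A B : adj2 (mul2 A B) = mul2 (adj2 B) (adj2 A).
Proof.
  unfold adj2, mul2; cbn [m11 m12 m21 m22]; rewrite !Cplus_conj, !Cmult_conj; f_equal; ring.
Qed.

Lemma act_mul2 A B (x : R31) : act A (act B x) = act (mul2 A B) x.
Proof. unfold act at 1 3; now rewrite herm_act, adj2_mul2, !mul2_assoc. Qed.

(** A times its adjugate is the scalar det A, which acts on R^{3,1} through
    |det A|^2; this inverts [act A] when A is invertible. *)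
Lemma act_adjugate A (x : R31) : act A (act (adjugate A) x) = scal (Cnorm2 (det2 A)) x.
Proof.
  rewrite act_mul2.
  replace (mul2 A (adjugate A)) with (mkM2C (det2 A) 0 0 (det2 A))
    by (unfold mul2, adjugate, det2; cbn; f_equal; ring).
  destruct (det2 A) as [r s]; coords; act_unfold; vec_unfold; vec_field.
Qed.

Lemma Cnorm2_pos z : z <> RtoC 0 -> 0 < Cnorm2 z.
Proof.
  destruct z as [a b]; unfold Cnorm2; cbn; intros H.
  pose proof (Rle_0_sqr a) as Ha; pose proof (Rle_0_sqr b) as Hb; unfold Rsqr in *.
  destruct (Req_dec a 0) as [-> | Ha'].
  - destruct (Req_dec b 0) as [-> | Hb']; [ now destruct H | ].
    pose proof (Rsqr_pos_lt b Hb'); unfold Rsqr in *; lra.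
  - pose proof (Rsqr_pos_lt a Ha'); unfold Rsqr in *; lra.
Qed.

Lemma act_surj A (y : R31) : det2 A <> RtoC 0 -> exists x, act A x = y.
Proof.
  intros HA; pose proof (Cnorm2_pos _ HA) as Hk.
  exists (act (adjugate A) (scal (/ Cnorm2 (det2 A)) y)).
  rewrite act_adjugate.
  revert Hk; generalize (Cnorm2 (det2 A)); intros k Hk.
  destruct y as [[[y1 y2] y3] y4]; vec_unfold.
  vec_field; lra.
Qed.

(** * Null vectors and stereographic projection *)

(** The lower right entry of the Hermitian matrix of p.  On nonzero null vectors
    it vanishes exactly over the point at infinity of CP^1. *)
Definition gap (p : R31) : R := let '(_, _, p3, p4) := p in p4 - p3.

(** Homogeneous of degree 0, so that null vectors need not be normalized before
    their stereographic coordinate is read off. *)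
Definition stereo (p : R31) : C :=
  let '(p1, p2, _, _) := p in (p1 / gap p, p2 / gap p).

Definition dstereo (p P : R31) : C :=
  let '(p1, p2, _, _) := p in
  let '(P1, P2, _, _) := P in
  ((P1 * gap p - p1 * gap P) / gap p ^ 2, (P2 * gap p - p2 * gap P) / gap p ^ 2).

(** The null vector with stereographic coordinate a + b i and gap 2. *)
Definition cone (a b : R) : R31 := (2 * a, 2 * b, a * a + b * b - 1, a * a + b * b + 1).

Definition dcone (a b α β : R) : R31 :=
  (2 * α, 2 * β, 2 * (a * α + b * β), 2 * (a * α + b * β)).

(** Nullity reads (p4 - p3) (p4 + p3) = p1^2 + p2^2, so the gap and the
    stereographic coordinate determine all four entries. *)
Lemma null_eq_cone (p : R31) : mink p p = 0 -> gap p <> 0 ->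
  p = scal (gap p / 2) (cone (fst (stereo p)) (snd (stereo p))).
Proof.
  destruct p as [[[p1 p2] p3] p4].
  unfold mink, gap, stereo, cone; vec_unfold; intros H H0.
  assert (E : p3 + p4 = (p1 * p1 + p2 * p2) / (p4 - p3)).
  { apply (Rmult_eq_reg_r (p4 - p3)); [ | assumption ].
    field_simplify; [ lra | assumption ]. }
  repeat apply injective_projections; cbn; try (field; assumption).
  - transitivity ((p3 + p4 - (p4 - p3)) / 2); [ field | rewrite E; field; assumption ].
  - transitivity ((p3 + p4 + (p4 - p3)) / 2); [ field | rewrite E; field; assumption ].
Qed.

(** Orthogonality to a null vector p is tangency to the light cone.  Such a
    vector splits into a radial part, which [stereo] ignores, and the lift of
    the velocity of the stereographic coordinate. *)
Lemma tangent_eq_dcone (p P : R31) : mink p p = 0 -> mink p P = 0 -> gap p <> 0 ->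
  P = plus (scal (gap P / gap p) p)
           (scal (gap p / 2) (dcone (fst (stereo p)) (snd (stereo p))
                                (fst (dstereo p P)) (snd (dstereo p P)))).
Proof.
  intros H1 H2 H0.
  rewrite (null_eq_cone p H1 H0) in H2.
  pose proof (null_eq_cone p H1 H0) as E.
  set (z := stereo p) in *.
  revert H2 H0 E; unfold dstereo; generalize (gap p); destruct p as [[[p1 p2] p3] p4];
  destruct z as [a b]; destruct P as [[[P1 P2] P3] P4].
  unfold mink, gap, cone, dcone; vec_unfold; intros d H2 H0 E.
  injection E as -> -> -> ->.
  assert (E : P3 + P4 = 2 * (a * P1 + b * P2) - (a * a + b * b) * (P4 - P3)).
  { apply (Rmult_eq_reg_r d); [ lra | assumption]. }
  assert (E' : P4 = a * P1 + b * P2 - (a * a + b * b - 1) * (P4 - P3) / 2) by lra.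
  assert (E'' : P3 = a * P1 + b * P2 - (a * a + b * b + 1) * (P4 - P3) / 2) by lra.
  set (e := P4 - P3) in *.
  rewrite E', E''.
  vec_field; assumption.
Qed.

(** The first identity, -2 |z - w|^2, differentiated in z, in w, and in both. *)
Lemma mink_cone (z w ζ η : C) :
  let r := fst z - fst w in
  let s := snd z - snd w in
  mink (cone (fst z) (snd z)) (cone (fst w) (snd w)) = - 2 * (r * r + s * s) /\
  mink (dcone (fst z) (snd z) (fst ζ) (snd ζ)) (cone (fst w) (snd w)) =
    - 4 * (r * fst ζ + s * snd ζ) /\
  mink (cone (fst z) (snd z)) (dcone (fst w) (snd w) (fst η) (snd η)) =
    4 * (r * fst η + s * snd η) /\
  mink (dcone (fst z) (snd z) (fst ζ) (snd ζ)) (dcone (fst w) (snd w) (fst η) (snd η)) =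
    4 * (fst ζ * fst η + snd ζ * snd η).
Proof. unfold mink, cone, dcone; cbn; repeat split; ring. Qed.

(** Since 1 / δ^2 = (conj δ)^2 / |δ|^4, this is the identity
    Re ((conj δ)^2 ζ η) =
      2 Re (conj δ ζ) Re (conj δ η) - |δ|^2 Re (conj ζ η). *)
Lemma Re_pairing_over_square (δ ζ η : C) :
  let N := fst δ * fst δ + snd δ * snd δ in
  N <> 0 ->
  Re (4 / (δ * δ) * (ζ * η))%C =
  (8 * (fst δ * fst ζ + snd δ * snd ζ) * (fst δ * fst η + snd δ * snd η)
   - 4 * N * (fst ζ * fst η + snd ζ * snd η)) / N ^ 2.
Proof.
  destruct δ as [r s], ζ as [α β], η as [α' β']; cbn; intros N.
  unfold Re; cbn.
  replace ((r * r - s * s) * ((r * r - s * s) * 1) + (r * s + s * r) * ((r * s + s * r) * 1))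
    with ((r * r + s * s) ^ 2) by ring.
  field.
  exact N.
Qed.

(** The heart of the comparison.  Orthogonality of P to m and of M to p fixes
    the radial parts of P and M, which leaves
      <P, M> / <p, m> =
        (<dc, dc'> <c, c'> - <dc, c'> <c, dc'>) / <c, c'>^2
    where c, c' are the cone vectors below p and m, and dc, dc' their
    derivatives along the velocities of the coordinates. *)
Lemma Re_stereo_metric (p m P M : R31) :
  mink p p = 0 -> mink m m = 0 ->
  mink p P = 0 -> mink m P = 0 -> mink p M = 0 -> mink m M = 0 ->
  gap p <> 0 -> gap m <> 0 -> mink p m <> 0 ->
  Re (4 / ((stereo p - stereo m) * (stereo p - stereo m)) * (dstereo p P * dstereo m M))%C
  = 2 * mink P M / mink p m.
Proof.
  intros Np Nm pP mP pM mM gp gm pm.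
  pose proof (null_eq_cone p Np gp) as Ep.
  pose proof (null_eq_cone m Nm gm) as Em.
  pose proof (tangent_eq_dcone p P Np pP gp) as EP.
  pose proof (tangent_eq_dcone m M Nm mM gm) as EM.
  revert gp gm Ep Em EP EM.
  generalize (gap P / gap p) (gap M / gap m).
  generalize (gap p) (gap m) (stereo p) (stereo m) (dstereo p P) (dstereo m M).
  intros d e z w ζ η δ ε gp gm Ep Em EP EM.
  destruct (mink_cone z w ζ η) as (Kcc & Kdc & Kcd & Kdd).
  revert Ep Em EP EM Kcc Kdc Kcd Kdd.
  generalize (cone (fst z) (snd z)) (cone (fst w) (snd w)).
  generalize (dcone (fst z) (snd z) (fst ζ) (snd ζ)) (dcone (fst w) (snd w) (fst η) (snd η)).
  intros dc dc' c c' Ep Em EP EM Kcc Kdc Kcd Kdd.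
  assert (Epm : mink p m = d * e / 4 * mink c c').
  { rewrite Ep, Em, mink_scal_l, mink_scal_r; field. }
  assert (HcP : δ * mink p m = - (d * e / 4) * mink dc c').
  { rewrite (mink_sym m P), EP, mink_plus_l, !mink_scal_l in mP.
    rewrite Em in mP at 2; rewrite mink_scal_r in mP; lra. }
  assert (HcM : mink p dc' = d / 2 * mink c dc').
  { rewrite Ep, mink_scal_l; reflexivity. }
  assert (HPM : mink P M * mink p m =
                (d * e / 4) ^ 2 * (mink dc dc' * mink c c' - mink dc c' * mink c dc')).
  { replace (mink P M) with (e / 2 * (δ * mink p dc' + d / 2 * mink dc dc')).
    - replace (e / 2 * (δ * mink p dc' + d / 2 * mink dc dc') * mink p m)
        with (e / 2 * (mink p dc' * (δ * mink p m) + d / 2 * mink dc dc' * mink p m)) by ring.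
      rewrite HcP, HcM, Epm; field.
    - rewrite EM, mink_plus_r, !mink_scal_r, (mink_sym P m), mP.
      rewrite EP, mink_plus_l, !mink_scal_l; ring. }
  assert (Hde : d * e <> 0) by now apply Rmult_integral_contrapositive_currified.
  assert (HN : mink c c' <> 0) by (intros h; apply pm; rewrite Epm, h; ring).
  replace (2 * mink P M / mink p m) with (2 * (mink P M * mink p m) / mink p m ^ 2)
    by (field; assumption).
  (* The factors d and e cancel; what is left is an identity in z, w, ζ, η. *)
  rewrite HPM, Epm.
  rewrite Kcc in HN |- *; rewrite Kdd, Kdc, Kcd.
  rewrite Re_pairing_over_square; cbn [fst snd Cminus Cplus Copp].
  - change (fst z + - fst w) with (fst z - fst w); change (snd z + - snd w) with (snd z - snd w).
    field; lra.
  - change (fst z + - fst w) with (fst z - fst w); change (snd z + - snd w) with (snd z - snd w).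
    lra.
Qed.

(** Adding a multiple of p changes neither the orthogonality to p nor the value
    of [dstereo p]; as <p, m> is nonzero, it can be used to reach
    orthogonality to m. *)
Lemma dstereo_surj (p m : R31) (ζ : C) :
  mink p p = 0 -> gap p <> 0 -> mink p m <> 0 ->
  exists P, mink p P = 0 /\ mink m P = 0 /\ dstereo p P = ζ.
Proof.
  intros Np gp pm.
  set (T := dcone (fst (stereo p)) (snd (stereo p)) (fst ζ) (snd ζ)).
  exists (plus (scal (- (gap p / 2 * mink m T) / mink p m) p) (scal (gap p / 2) T)).
  rewrite !mink_plus_r, !mink_scal_r, Np, (mink_sym m p).
  repeat split.
  - assert (H : mink p T = 0); [ | rewrite H; field; assumption ].
    pose proof (null_eq_cone p Np gp) as E; rewrite E at 1.
    rewrite mink_scal_l; unfold T, cone, dcone, mink; field.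
  - field; assumption.
  - generalize (- (gap p / 2 * mink m T) / mink p m); intros δ.
    unfold T; clear T Np pm.
    destruct ζ as [α β]; revert gp; coords.
    unfold dstereo, stereo, gap, dcone; vec_unfold; intros gp.
    apply injective_projections; cbn; field; assumption.
Qed.

(** * The boundary at infinity *)

Lemma klein_null (p : R31) : mink p p = 0 -> time p <> 0 ->
  mink (klein p) (klein p) = 0 /\ time (klein p) = 1.
Proof.
  intros H Ht; unfold klein; split.
  - rewrite mink_scal_l, mink_scal_r, H; ring.
  - change (/ time p * time p = 1); field; assumption.
Qed.

Lemma null_time_0 (p : R31) : mink p p = 0 -> time p = 0 -> p = (0, 0, 0, 0).
Proof.
  coords; unfold mink, time; cbn; intros H ->.
  repeat apply injective_projections; cbn; nra.
Qed.

(** By equivariance, the Mobius transformation of A carries the null line of p to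
    that of [act A p], so a chart of CP^1 in the general position A is the
    standard stereographic coordinate after a linear map. *)
Lemma mobius_bd_to_CP1 A (n : bdH3) (p : R31) :
  det2 A <> RtoC 0 -> mink p p = 0 -> 0 < time p -> proj1_sig n = klein p ->
  mobius A (bd_to_CP1 n) =
  if Req_dec_T (gap (act A p)) 0 then CInf else CFin (stereo (act A p)).
Proof.
  intros HA Np tp En.
  set (y := act A p).
  assert (Ny : mink y y = 0) by (unfold y; rewrite mink_act, Np; ring).
  assert (Ty : time y <> 0).
  { (* Otherwise y = 0, and p would be orthogonal to every vector. *)
    intros Ty; apply (null_time_0 y Ny) in Ty.
    pose proof (Cnorm2_pos _ HA) as Hk.
    assert (H : forall x, mink p x = 0).
    { intros x. apply (Rmult_eq_reg_l (Cnorm2 (det2 A))); [ | lra ].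
      rewrite <- mink_act. fold y; rewrite Ty. destruct (act A x) as [[[? ?] ?] ?]; unfold mink; ring. }
    specialize (H (0, 0, 0, 1)); revert H tp; coords; unfold mink, time; cbn; lra. }
  rewrite <- (bd_to_CP1_equivariant A n (exist _ (klein y) (klein_null y Ny Ty)) (time y / time p) HA).
  - clear - Ty. unfold bd_to_CP1; cbn [proj1_sig].
    destruct y as [[[y1 y2] y3] y4]; unfold klein, gap, stereo, time in *.
    vec_unfold; cbn in Ty.
    destruct (Req_dec_T _ 1) as [h | h]; destruct (Req_dec_T _ 0) as [h' | h']; try reflexivity.
    + exfalso; apply h'.
      replace (y4 - y3) with (y4 * (1 - / y4 * y3)) by (field; assumption). rewrite h; ring.
    + exfalso; apply h. replace y3 with (y4 - (y4 - y3)) by ring; rewrite h'; field; assumption.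
    + f_equal; apply injective_projections; cbn; field; split; try assumption; lra.
  - cbn [proj1_sig]. rewrite <- herm_act, En.
    f_equal. unfold klein at 2. rewrite act_scal. fold y.
    clear - Ty tp. unfold klein. revert Ty tp. generalize (time y) (time p); intros a b Ha Hb.
    destruct y as [[[y1 y2] y3] y4].  vec_unfold.
    vec_field; lra.
Qed.

(** * Unit tangent vectors of hyperbolic space *)

(** The null vector on the ray through the final endpoint for σ = 1, through
    the initial endpoint for σ = -1. *)
Definition ideal (σ : R) (q : T1H3) : R31 := plus (basept q) (scal σ (direction q)).

Lemma mink_basept q : mink (basept q) (basept q) = -1.
Proof. exact (proj1 (proj1 (proj2_sig q))). Qed.

Lemma mink_basept_direction q : mink (basept q) (direction q) = 0.
Proof. exact (proj1 (proj2 (proj2_sig q))). Qed.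

Lemma mink_direction q : mink (direction q) (direction q) = 1.
Proof. exact (proj2 (proj2 (proj2_sig q))). Qed.

Lemma time_basept q : 0 < time (basept q).
Proof. exact (proj2 (proj1 (proj2_sig q))). Qed.

Lemma mink_ideal σ τ q : mink (ideal σ q) (ideal τ q) = σ * τ - 1.
Proof.
  unfold ideal; rewrite !mink_plus_l, !mink_plus_r, !mink_scal_l, !mink_scal_r.
  rewrite (mink_sym (direction q) (basept q)), mink_basept, mink_basept_direction, mink_direction.
  ring.
Qed.

Lemma cauchy_schwarz3 a b c x y z :
  (a * x + b * y + c * z) ^ 2 <= (a * a + b * b + c * c) * (x * x + y * y + z * z).
Proof.
  pose proof (pow2_ge_0 (a * y - b * x)); pose proof (pow2_ge_0 (a * z - c * x));
  pose proof (pow2_ge_0 (b * z - c * y)); nra.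
Qed.

(** Orthogonality says that x4 u4 is the spatial product of x and u, which
    Cauchy-Schwarz bounds; the squared spatial norm of x is x4^2 - 1. *)
Lemma orthogonal_timelike (x u : R31) :
  in_H3 x -> mink x u = 0 -> time u ^ 2 <= mink u u * (time x ^ 2 - 1).
Proof.
  destruct x as [[[x1 x2] x3] x4], u as [[[u1 u2] u3] u4].
  intros [Hx _] Hu; unfold mink, time in *; cbn [snd] in *.
  pose proof (cauchy_schwarz3 x1 x2 x3 u1 u2 u3) as H.
  replace (x1 * u1 + x2 * u2 + x3 * u3) with (x4 * u4) in H by lra.
  replace (x1 * x1 + x2 * x2 + x3 * x3) with (x4 ^ 2 - 1) in H by lra.
  lra.
Qed.

(** The bound on the time component of a vector orthogonal to x shows that the
    direction v satisfies |v4| < x4. *)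
Lemma time_ideal σ q : σ * σ = 1 -> 0 < time (ideal σ q).
Proof.
  intros Hσ.
  pose proof (orthogonal_timelike _ _ (proj1 (proj2_sig q)) (mink_basept_direction q)) as H.
  change (snd (proj1_sig q)) with (direction q) in H.
  change (fst (proj1_sig q)) with (basept q) in H.
  rewrite mink_direction in H.
  pose proof (time_basept q).
  change (time (ideal σ q)) with (time (basept q) + σ * time (direction q)).
  nra.
Qed.

Lemma orthogonal_spacelike (x u : R31) : in_H3 x -> mink x u = 0 -> 0 <= mink u u.
Proof.
  intros Hx Hu. pose proof (orthogonal_timelike x u Hx Hu) as H.
  destruct Hx as [Hx Hx4]; revert H Hx Hx4; coords; unfold mink, time; cbn [snd]; intros.
  nra.
Qed.

(** Vectors on opposite sheets of the hyperboloid have a positive product, by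
    Cauchy-Schwarz, so a negative product keeps y on the sheet of x. *)
Lemma in_H3_of_mink_neg (x y : R31) :
  in_H3 x -> mink y y = -1 -> mink x y < 0 -> in_H3 y.
Proof.
  destruct x as [[[x1 x2] x3] x4], y as [[[y1 y2] y3] y4].
  intros [Hx Hx4] Hy Hxy; split; [ exact Hy | ]; unfold mink, time in *; cbn [snd] in *.
  pose proof (cauchy_schwarz3 x1 x2 x3 y1 y2 y3) as H.
  replace (x1 * x1 + x2 * x2 + x3 * x3) with (x4 ^ 2 - 1) in H by lra.
  replace (y1 * y1 + y2 * y2 + y3 * y3) with (y4 ^ 2 - 1) in H by lra.
  apply Rnot_le_lt; intros Hy4.
  assert (x4 * y4 <= 0) by nra.
  assert (1 <= x4 ^ 2 /\ 1 <= y4 ^ 2) by (split; nra).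
  assert ((x4 * y4) ^ 2 < (x1 * y1 + x2 * y2 + x3 * y3) ^ 2) by nra.
  nra.
Qed.

(** * Endpoints of geodesics *)

Lemma klein_scal (k : R) (p : R31) : k <> 0 -> time p <> 0 -> klein (scal k p) = klein p.
Proof.
  intros Hk Hp; unfold klein; change (time (scal k p)) with (k * time p).
  revert Hp; generalize (time p); intros t Ht.
  destruct p as [[[p1 p2] p3] p4]; vec_unfold.
  vec_field; split; assumption.
Qed.

(** Hyperbolic functions are combinations of exponentials, and the geodesic flow
    scales the null vectors x + v and x - v by e^t and e^{-t}.  In this form the
    direction of the geodesic visibly tends to that of [ideal σ q]. *)
Lemma geodesic_ideal σ q t : σ = 1 \/ σ = -1 ->
  geodesic q t = scal (exp (σ * t) / 2)
                      (plus (ideal σ q) (scal (exp (- 2 * σ * t)) (ideal (- σ) q))).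
Proof.
  intros Hσ.
  assert (E : exp (- 2 * σ * t) = exp (- (σ * t)) * / exp (σ * t)).
  { rewrite <- exp_Ropp, <- exp_plus; f_equal; ring. }
  rewrite E.
  unfold geodesic, ideal; generalize (basept q) (direction q); intros x v.
  assert (Ec : cosh t = (exp (σ * t) + exp (- (σ * t))) / 2 /\
               sinh t = σ * (exp (σ * t) - exp (- (σ * t))) / 2).
  { unfold cosh, sinh; destruct Hσ as [-> | ->].
    - rewrite !Rmult_1_l; split; field.
    - replace (-1 * t) with (- t) by ring; rewrite Ropp_involutive; split; field. }
  destruct Ec as [-> ->].
  pose proof (exp_pos (σ * t)) as Hp; revert Hp.
  generalize (exp (σ * t)) (exp (- (σ * t))); intros a b Ha.
  coords; vec_unfold.
  vec_field; lra.
Qed.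

(** Unit vectors with the same oriented geodesic are related by the geodesic
    flow, so their null vectors span the same lines: the endpoint does not
    depend on the chosen unit vector. *)
Lemma ideal_geodesic σ q q' : σ = 1 \/ σ = -1 -> pG q' = pG q ->
  exists k, 0 < k /\ ideal σ q' = scal k (ideal σ q).
Proof.
  intros Hσ E.
  pose proof (f_equal (fun l : G3 => proj1_sig l (proj1_sig q')) E) as E'; cbn [proj1_sig pG] in E'.
  assert (H : exists t, proj1_sig q' = (geodesic q t, geodesic_velocity q t)).
  { (* q' itself, at time 0, belongs to the lift of the common geodesic. *)
    rewrite <- E'.
    exists 0; unfold geodesic, geodesic_velocity; rewrite cosh_0, sinh_0.
    unfold basept, direction; destruct (proj1_sig q') as [x v]; cbn [fst snd].
    coords; vec_unfold; repeat apply injective_projections; cbn; ring. }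
  destruct H as [t Ht]; exists (exp (σ * t)); split; [ apply exp_pos | ].
  unfold ideal at 1, basept, direction; rewrite Ht; cbn [fst snd].
  unfold geodesic, geodesic_velocity, ideal.
  assert (Ec : exp (σ * t) = cosh t + σ * sinh t /\ σ * σ = 1).
  { unfold cosh, sinh; destruct Hσ as [-> | ->].
    - rewrite Rmult_1_l; split; field.
    - replace (-1 * t) with (- t) by ring; split; field. }
  destruct Ec as [-> Hσ2]; generalize (basept q) (direction q) (cosh t) (sinh t); intros x v a b.
  coords; vec_unfold.
  repeat apply injective_projections; cbn;
   match goal with |- a * ?x + b * ?v + σ * (b * ?x + a * ?v) = _ =>
     transitivity (a * x + σ * σ * (b * v) + σ * (b * x + a * v)); [ rewrite Hσ2 | ]; ring end.
Qed.

Lemma klein_continuous (p m : R31) : 0 < time p ->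
  filterlim (fun ε : R => klein (plus p (scal ε m))) (locally 0) (locally (klein p)).
Proof.
  intros Hp.
  set (f := fun ε : R => plus p (scal ε m) : R31).
  assert (E0 : f 0 = p)
    by (unfold f; coords; vec_unfold; repeat apply injective_projections; cbn; ring).
  assert (Hf : @continuous _ R31_module f 0).
  { apply (continuous_plus (V := R31_module) (fun _ => p) (fun ε : R => scal ε m)).
    - apply continuous_const.
    - apply (continuous_scal_l (V := R31_module) (fun ε : R => ε) m), continuous_id. }
  replace (klein p) with (klein (f 0)) by now rewrite E0.
  apply (continuous_scal (V := R31_module) (fun ε => / time (f ε)) f); [ | exact Hf ].
  apply (continuous_Rinv_comp (fun ε => time (f ε))).
  - apply (continuous_comp f (fun x : R31_module => snd x)); [ exact Hf | ].
    exact (linear_cont (U := R31_module) snd _ is_linear_snd).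
  - rewrite E0; lra.
Qed.

(** Ties the sign in [ideal] to the end of the time axis, so that final and initial
    endpoints are treated together. *)
Definition side (σ : R) (s : Rbar) : Prop := (σ = 1 /\ s = p_infty) \/ (σ = -1 /\ s = m_infty).

Lemma geodesic_limit σ s q : side σ s ->
  filterlim (fun t => klein (geodesic q t)) (Rbar_locally s) (locally (klein (ideal σ q))).
Proof.
  intros Hs.
  assert (Hσ : σ = 1 \/ σ = -1) by (destruct Hs as [[-> _] | [-> _]]; auto).
  assert (Hσ2 : σ * σ = 1) by (destruct Hσ as [-> | ->]; ring).
  pose proof (time_ideal σ q Hσ2) as Tp.
  assert (Hσ2' : - σ * - σ = 1) by lra.
  pose proof (time_ideal (- σ) q Hσ2') as Tm.
  apply (filterlim_ext (fun t => klein (plus (ideal σ q) (scal (exp (- 2 * σ * t)) (ideal (- σ) q))))).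
  { intros t; rewrite (geodesic_ideal σ q t Hσ), klein_scal; [ reflexivity | | ].
    - pose proof (exp_pos (σ * t)); lra.
    - change (time (ideal σ q) + exp (- 2 * σ * t) * time (ideal (- σ) q) <> 0).
      pose proof (exp_pos (- 2 * σ * t)); nra. }
  refine (filterlim_comp _ _ _ (fun t => exp (- 2 * σ * t)) _ _ _ _ _
            (klein_continuous (ideal σ q) (ideal (- σ) q) Tp)).
  assert (L : is_lim (fun t => exp (- 2 * σ * t)) s 0).
  { apply (is_lim_comp exp (fun t => - 2 * σ * t) s 0 m_infty is_lim_exp_m).
    - replace m_infty with (Rbar_mult (- 2 * σ) s).
      + apply is_lim_scal_l, is_lim_id.
      + destruct Hs as [[-> ->] | [-> ->]]; cbn.
        * destruct (Rle_dec 0 (- 2 * 1)) as [h | h]; [ exfalso; lra | reflexivity ].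
        * destruct (Rle_dec 0 (- 2 * -1)) as [h | h]; [ | exfalso; lra ].
          destruct (Rle_lt_or_eq_dec _ _ h); [ reflexivity | exfalso; lra ].
    - destruct Hs as [[-> ->] | [-> ->]]; exists 0; intros; discriminate. }
  destruct Hs as [[_ ->] | [_ ->]]; exact L.
Qed.

(** The choice in [endpoint] is made among the limits of all unit vectors of the
    geodesic at once: the limit found for q serves for all of them, and limits
    are unique. *)
Lemma endpoint_ideal σ s q : side σ s ->
  proj1_sig (endpoint s (pG q)) = klein (ideal σ q).
Proof.
  intros Hs.
  assert (Hσ : σ = 1 \/ σ = -1) by (destruct Hs as [[-> _] | [-> _]]; auto).
  assert (Hσ2 : σ * σ = 1) by (destruct Hσ as [-> | ->]; ring).
  pose proof (time_ideal σ q Hσ2) as Tp.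
  assert (Np : mink (ideal σ q) (ideal σ q) = 0) by (rewrite mink_ideal, Hσ2; ring).
  assert (H : exists n : bdH3, forall q', pG q' = pG q ->
    filterlim (fun t => klein (geodesic q' t)) (Rbar_locally s) (locally (proj1_sig n))).
  { exists (exist _ (klein (ideal σ q)) (klein_null _ Np (Rgt_not_eq _ _ Tp))).
    intros q' E; cbn [proj1_sig].
    destruct (ideal_geodesic σ q q' Hσ E) as [k [Hk Ek]].
    rewrite <- (klein_scal k), <- Ek by lra.
    now apply geodesic_limit. }
  pose proof (epsilon_spec bdH3_inhabited _ H q eq_refl) as L; fold (endpoint s (pG q)) in L.
  exact (filterlim_locally_unique (K := R_AbsRing) _ _ _ L (geodesic_limit σ s q Hs)).
Qed.

(** * The differential of the projection in a chart *)

Lemma is_derive_pair {U V : NormedModule R_AbsRing} (f : R -> U) (g : R -> V) (x : R) (lf : U) (lg : V) :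
  is_derive f x lf -> is_derive g x lg ->
  is_derive (V := prod_NormedModule R_AbsRing U V) (fun t => (f t, g t)) x (lf, lg).
Proof.
  intros Hf Hg.
  apply (filterdiff_comp'_2 f g pair x _ _ pair Hf Hg).
  exact (filterdiff_linear _ (is_linear_prod _ _ is_linear_fst is_linear_snd)).
Qed.

Lemma is_derive_linear {U V : NormedModule R_AbsRing} (f : R -> U) (h : U -> V) (x : R) (l : U) :
  is_linear h -> is_derive f x l -> is_derive (fun t => h (f t)) x (h l).
Proof.
  intros Hh Hf.
  apply (filterdiff_ext_lin _ (fun y : R => h (scal y l))).
  - exact (filterdiff_comp' f h x _ h Hf (filterdiff_linear _ Hh)).
  - intros y; exact (linear_scal h Hh y l).
Qed.

Lemma is_linear_gap : is_linear (gap : R31_module -> R_NormedModule).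
Proof.
  apply is_linear_R31; intros; coords; unfold gap; vec_unfold; ring.
Qed.

Lemma is_linear_act A : is_linear (act A : R31_module -> R31_module).
Proof. apply is_linear_R31; intros; [ apply act_plus | apply act_scal ]. Qed.

Lemma is_derive_stereo (y : R -> R31) (l : R31) :
  gap (y 0) <> 0 -> is_derive (V := R31_module) y 0 l ->
  is_derive (V := prod_NormedModule R_AbsRing R_NormedModule R_NormedModule)
    (fun t => stereo (y t)) 0 (dstereo (y 0) l).
Proof.
  intros Hg Hy.
  pose proof (is_derive_linear (V := R_NormedModule) y gap 0 l is_linear_gap Hy) as Dg.
  set (p1 := fun p : R31 => let '(p1, _, _, _) := p in p1).
  set (p2 := fun p : R31 => let '(_, p2, _, _) := p in p2).
  assert (L1 : is_linear (p1 : R31_module -> R_NormedModule))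
    by (apply is_linear_R31; intros; coords; reflexivity).
  assert (L2 : is_linear (p2 : R31_module -> R_NormedModule))
    by (apply is_linear_R31; intros; coords; reflexivity).
  pose proof (is_derive_linear (V := R_NormedModule) y p1 0 l L1 Hy) as D1.
  pose proof (is_derive_linear (V := R_NormedModule) y p2 0 l L2 Hy) as D2.
  apply (is_derive_ext (fun t => (p1 (y t) / gap (y t), p2 (y t) / gap (y t)))).
  { intros t; destruct (y t) as [[[? ?] ?] ?]; reflexivity. }
  replace (dstereo (y 0) l)
    with ((p1 l * gap (y 0) - p1 (y 0) * gap l) / gap (y 0) ^ 2,
          (p2 l * gap (y 0) - p2 (y 0) * gap l) / gap (y 0) ^ 2)
    by (destruct (y 0) as [[[? ?] ?] ?], l as [[[? ?] ?] ?]; reflexivity).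
  apply (is_derive_pair (U := R_NormedModule) (V := R_NormedModule)); apply is_derive_div; assumption.
Qed.

Lemma mobius_endpoint A σ s q : det2 A <> RtoC 0 -> side σ s ->
  mobius A (bd_to_CP1 (endpoint s (pG q))) =
  if Req_dec_T (gap (act A (ideal σ q))) 0 then CInf else CFin (stereo (act A (ideal σ q))).
Proof.
  intros HA Hs.
  assert (Hσ2 : σ * σ = 1) by (destruct Hs as [[-> _] | [-> _]]; ring).
  apply mobius_bd_to_CP1; [ exact HA | | | ].
  - rewrite mink_ideal, Hσ2; ring.
  - now apply time_ideal.
  - now apply endpoint_ideal.
Qed.

Lemma chart_dom_endpoint A σ s q : det2 A <> RtoC 0 -> side σ s ->
  chart_dom A (bd_to_CP1 (endpoint s (pG q))) <-> gap (act A (ideal σ q)) <> 0.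
Proof.
  intros HA Hs; unfold chart_dom; rewrite (mobius_endpoint A σ s q HA Hs).
  destruct (Req_dec_T _ 0) as [h | h]; split; congruence.
Qed.

Lemma chart_endpoint A σ s q : det2 A <> RtoC 0 -> side σ s ->
  gap (act A (ideal σ q)) <> 0 ->
  chart A (bd_to_CP1 (endpoint s (pG q))) = stereo (act A (ideal σ q)).
Proof.
  intros HA Hs H; unfold chart; rewrite (mobius_endpoint A σ s q HA Hs).
  destruct (Req_dec_T _ 0) as [h | h]; [ contradiction | reflexivity ].
Qed.

Lemma side_final : side 1 p_infty. Proof. left; auto. Qed.

Lemma side_initial : side (-1) m_infty. Proof. right; auto. Qed.

(** [ideal σ] and [act A] are linear, so the chart of the endpoint is [stereo]
    after a linear map.  That formula holds only inside the chart domain,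
    which is open; hence near 0 along the curve. *)
Lemma is_derive_chart_endpoint A σ s (c : R -> T1H3) (w u : R31) :
  det2 A <> RtoC 0 -> side σ s ->
  gap (act A (ideal σ (c 0))) <> 0 ->
  is_derive (V := prod_NormedModule R_AbsRing R31_module R31_module)
    (fun t => proj1_sig (c t)) 0 (w, u) ->
  is_derive (V := prod_NormedModule R_AbsRing R_NormedModule R_NormedModule)
    (fun t => chart A (bd_to_CP1 (endpoint s (pG (c t))))) 0
    (dstereo (act A (ideal σ (c 0))) (act A (plus w (scal σ u)))).
Proof.
  intros HA Hs H0 Hc.
  set (h := fun r : prod_NormedModule R_AbsRing R31_module R31_module =>
              plus (fst r) (scal σ (snd r)) : R31_module).
  assert (Lh : is_linear h).
  { apply (is_linear_comp (fun r => (fst r, scal σ (snd r))) (fun r => plus (fst r) (snd r)));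
      [ | apply is_linear_plus ].
    apply is_linear_prod; [ apply is_linear_fst | ].
    apply (is_linear_comp snd (fun x => scal σ x)); [ apply is_linear_snd | ].
    exact (is_linear_scal_r (K := R_AbsRing) (V := R31_module) σ Rmult_comm). }
  pose proof (is_derive_linear _ h 0 _ Lh Hc) as Hi.
  pose proof (is_derive_linear _ (act A) 0 _ (is_linear_act A) Hi) as Ha.
  apply (is_derive_ext_loc (fun t => stereo (act A (ideal σ (c t))))).
  - assert (Hg : continuous (fun t => gap (act A (ideal σ (c t)))) 0).
    { apply (ex_derive_continuous (V := R_NormedModule)); eexists.
      exact (is_derive_linear (V := R_NormedModule) _ gap 0 _ is_linear_gap Ha). }
    apply (filter_imp (fun t => gap (act A (ideal σ (c t))) <> 0)).
    + intros t Ht; symmetry; now apply chart_endpoint.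
    + apply (Hg (fun z => z <> 0)), open_neq, H0.
  - exact (is_derive_stereo (fun t => act A (ideal σ (c t))) _ H0 Ha).
Qed.

(** The differential of the projection to the space of geodesics, in the chart
    of A, at w^H + u^V. *)
Definition dchartG (A : M2C) (q : T1H3) (w u : R31) : C * C :=
  (dstereo (act A (ideal 1 q)) (act A (plus w (scal 1 u))),
   dstereo (act A (ideal (-1) q)) (act A (plus w (scal (-1) u)))).

Lemma is_dpG_dchartG A q w u : det2 A <> RtoC 0 -> chartG_dom A (pG q) ->
  is_dpG A q (lift w u) (dchartG A q w u).
Proof.
  intros HA [Hf Hi] c Hc Dc; subst q.
  apply (chart_dom_endpoint A _ _ _ HA side_final) in Hf.
  apply (chart_dom_endpoint A _ _ _ HA side_initial) in Hi.
  apply (is_derive_pair (U := prod_NormedModule R_AbsRing R_NormedModule R_NormedModule)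
                        (V := prod_NormedModule R_AbsRing R_NormedModule R_NormedModule)).
  - exact (is_derive_chart_endpoint A 1 p_infty c w u HA side_final Hf Dc).
  - exact (is_derive_chart_endpoint A (-1) m_infty c w u HA side_initial Hi Dc).
Qed.

(** * Curves of unit tangent vectors *)

Lemma is_derive_R31 (f1 f2 f3 f4 : R -> R) (x l1 l2 l3 l4 : R) :
  is_derive f1 x l1 -> is_derive f2 x l2 -> is_derive f3 x l3 -> is_derive f4 x l4 ->
  is_derive (V := R31_module) (fun t => (f1 t, f2 t, f3 t, f4 t)) x (l1, l2, l3, l4).
Proof.
  intros H1 H2 H3 H4.
  exact (is_derive_pair _ _ _ _ _ (is_derive_pair _ _ _ _ _ (is_derive_pair _ _ _ _ _ H1 H2) H3) H4).
Qed.

(** The base point follows X = sqrt (1 + t^2 <w, w>) x + t w, which stays on the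
    hyperboloid because <x, w> = 0 and <x, x> = -1.  The direction is v + t u,
    made orthogonal to X by adding t^2 <w, u> X and then normalized; both
    corrections are of second order in t. *)
Lemma tangent_curve (q : T1H3) (w u : R31) : normal_to q w -> normal_to q u ->
  exists c : R -> T1H3, c 0 = q /\
    is_derive (V := prod_NormedModule R_AbsRing R31_module R31_module)
      (fun t => proj1_sig (c t)) 0 (w, u).
Proof.
  destruct q as [[x v] Hq]; unfold normal_to, basept, direction; cbn [fst snd proj1_sig].
  intros [wx wv] [ux uv].
  pose proof Hq as [Hx [xv vv]]; cbn [fst snd] in Hx, xv, vv.
  set (a := mink w w); set (b := mink w u); set (e := mink u u).
  assert (Ha : 0 <= a) by (apply (orthogonal_spacelike x); [ | rewrite mink_sym ]; assumption).
  assert (He : 0 <= e) by (apply (orthogonal_spacelike x); [ | rewrite mink_sym ]; assumption).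
  set (X := fun t : R => plus (scal (sqrt (1 + t ^ 2 * a)) x) (scal t w) : R31).
  set (Y := fun t : R => plus (plus v (scal t u)) (scal (t ^ 2 * b) (X t)) : R31).
  set (N := fun t : R => 1 + t ^ 2 * e + (t ^ 2 * b) ^ 2).
  set (V := fun t : R => scal (/ sqrt (N t)) (Y t) : R31).
  assert (HN : forall t, 0 < N t).
  { intros t; unfold N; pose proof (pow2_ge_0 t); pose proof (pow2_ge_0 (t ^ 2 * b)); nra. }
  assert (Hs : forall t, sqrt (1 + t ^ 2 * a) * sqrt (1 + t ^ 2 * a) = 1 + t ^ 2 * a).
  { intros t; apply sqrt_sqrt; pose proof (pow2_ge_0 t); nra. }
  assert (XX : forall t, mink (X t) (X t) = -1).
  { intros t; unfold X.
    rewrite !mink_plus_l, !mink_plus_r, !mink_scal_l, !mink_scal_r, (mink_sym x w), wx, (proj1 Hx).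
    fold a; pose proof (Hs t); lra. }
  assert (HX : forall t, in_H3 (X t)).
  { intros t; apply (in_H3_of_mink_neg x); [ exact Hx | apply XX | ].
    unfold X; rewrite mink_plus_r, !mink_scal_r, (mink_sym x w), wx, (proj1 Hx).
    assert (0 < sqrt (1 + t ^ 2 * a)) by (apply sqrt_lt_R0; pose proof (pow2_ge_0 t); nra).
    lra. }
  assert (Xvu : forall t, mink (X t) (plus v (scal t u)) = t ^ 2 * b).
  { intros t; unfold X.
    rewrite !mink_plus_l, !mink_plus_r, !mink_scal_l, !mink_scal_r.
    rewrite xv, (mink_sym x u), ux, wv; unfold b; ring. }
  assert (XY : forall t, mink (X t) (Y t) = 0).
  { intros t; unfold Y; rewrite mink_plus_r, mink_scal_r, XX, Xvu; ring. }
  assert (YY : forall t, mink (Y t) (Y t) = N t).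
  { intros t; unfold Y at 2; rewrite mink_plus_r, mink_scal_r, (mink_sym (Y t) (X t)), XY.
    unfold Y; rewrite mink_plus_l, mink_scal_l, Xvu.
    rewrite !mink_plus_l, !mink_plus_r, !mink_scal_l, !mink_scal_r, (mink_sym v u), vv, uv.
    unfold N, e; ring. }
  assert (HV : forall t, in_H3 (X t) /\ mink (X t) (V t) = 0 /\ mink (V t) (V t) = 1).
  { intros t; split; [ apply HX | ]; unfold V.
    rewrite !mink_scal_r, mink_scal_l, XY, YY; split; [ ring | ].
    pose proof (sqrt_sqrt (N t) (Rlt_le _ _ (HN t))) as E.
    pose proof (sqrt_lt_R0 _ (HN t)).
    rewrite <- E at 3; field; lra. }
  exists (fun t => exist _ (X t, V t) (HV t)).
  split.
  - (* Elements of T1H3 with equal vectors are equal by proof irrelevance. *)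
    assert (E : (X 0, V 0) = (x, v)).
    { assert (EX : X 0 = x).
      { unfold X; replace (1 + 0 ^ 2 * a) with 1 by ring; rewrite sqrt_1; clear.
        coords; vec_unfold; repeat apply injective_projections; cbn; ring. }
      f_equal; [ exact EX | ].
      unfold V, Y, N; rewrite EX.
      replace (1 + 0 ^ 2 * e + (0 ^ 2 * b) ^ 2) with 1 by ring; rewrite sqrt_1; clear.
      coords; vec_unfold; vec_field. }
    revert E; generalize (HV 0); generalize (X 0) (V 0); intros X0 V0 H E.
    injection E; intros; subst X0 V0; f_equal; apply proof_irrelevance.
  - cbn [proj1_sig].
    apply is_derive_pair.
    + apply (is_derive_ext (fun t =>
        let '(x1, x2, x3, x4) := x in let '(w1, w2, w3, w4) := w in
        (sqrt (1 + t ^ 2 * a) * x1 + t * w1, sqrt (1 + t ^ 2 * a) * x2 + t * w2,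
         sqrt (1 + t ^ 2 * a) * x3 + t * w3, sqrt (1 + t ^ 2 * a) * x4 + t * w4))).
      { intros t; unfold X; destruct x as [[[? ?] ?] ?], w as [[[? ?] ?] ?]; reflexivity. }
      clearbody a; clear.
      destruct x as [[[? ?] ?] ?], w as [[[? ?] ?] ?].
      assert (D : forall k l : R, is_derive (fun t => sqrt (1 + t ^ 2 * a) * k + t * l) 0 l).
      { intros k l; auto_derive; [ lra | ]. cbn. field.
        replace (1 + 0 * (0 * 1) * a) with 1 by ring; rewrite sqrt_1; lra. }
      apply is_derive_R31; apply D.
    + apply (is_derive_ext (fun t =>
        let '(x1, x2, x3, x4) := x in let '(w1, w2, w3, w4) := w in
        let '(v1, v2, v3, v4) := v in let '(u1, u2, u3, u4) := u in
        let f x v w u := / sqrt (N t) * (v + t * u + t ^ 2 * b * (sqrt (1 + t ^ 2 * a) * x + t * w)) in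
        (f x1 v1 w1 u1, f x2 v2 w2 u2, f x3 v3 w3 u3, f x4 v4 w4 u4))).
      { intros t; unfold V, Y, X; destruct x as [[[? ?] ?] ?], w as [[[? ?] ?] ?],
          v as [[[? ?] ?] ?], u as [[[? ?] ?] ?]; reflexivity. }
      unfold N; clearbody a b e; clear.
      destruct x as [[[? ?] ?] ?], w as [[[? ?] ?] ?], v as [[[? ?] ?] ?], u as [[[? ?] ?] ?].
      assert (D : forall k l m n : R, is_derive (fun t =>
        / sqrt (1 + t ^ 2 * e + (t ^ 2 * b) ^ 2) *
          (l + t * n + t ^ 2 * b * (sqrt (1 + t ^ 2 * a) * k + t * m))) 0 n).
      { intros k l m n; auto_derive.
        - replace (1 + 0 * (0 * 1) * e + 0 * (0 * 1) * b * (0 * (0 * 1) * b * 1)) with 1 by ring.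
          rewrite sqrt_1; repeat split; lra.
        - cbn.
          replace (1 + 0 * (0 * 1) * e + 0 * (0 * 1) * b * (0 * (0 * 1) * b * 1)) with 1 by ring.
          replace (1 + 0 * (0 * 1) * a) with 1 by ring; rewrite sqrt_1; field. }
      apply is_derive_R31; apply D.
Qed.

(** [is_dpG] quantifies over curves, so it pins down its value only because some
    curve has the prescribed velocity. *)
Lemma is_dpG_iff A q w u Z : det2 A <> RtoC 0 -> chartG_dom A (pG q) ->
  normal_to q w -> normal_to q u ->
  is_dpG A q (lift w u) Z <-> Z = dchartG A q w u.
Proof.
  intros HA Hd Hw Hu; pose proof (is_dpG_dchartG A q w u HA Hd) as H0; split.
  - intros HZ; destruct (tangent_curve q w u Hw Hu) as [c [Hc Dc]].
    specialize (HZ c Hc Dc); specialize (H0 c Hc Dc); revert HZ H0.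
    generalize (dchartG A q w u); intros W DZ DW.
    pose (CC := prod_NormedModule R_AbsRing
                  (prod_NormedModule R_AbsRing R_NormedModule R_NormedModule)
                  (prod_NormedModule R_AbsRing R_NormedModule R_NormedModule)).
    assert (E : forall h : CC -> R_NormedModule, is_linear h -> h Z = h W).
    { intros h Lh.
      pose proof (is_derive_linear (U := CC) _ h 0 _ Lh DZ) as D1; apply is_derive_unique in D1.
      pose proof (is_derive_linear (U := CC) _ h 0 _ Lh DW) as D2; apply is_derive_unique in D2.
      now rewrite <- D1. }
    apply injective_projections; apply injective_projections.
    + exact (E (fun z => fst (fst z)) (is_linear_comp fst fst is_linear_fst is_linear_fst)).
    + exact (E (fun z => snd (fst z)) (is_linear_comp fst snd is_linear_fst is_linear_snd)).
    + exact (E (fun z => fst (snd z)) (is_linear_comp snd fst is_linear_snd is_linear_fst)).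
    + exact (E (fun z => snd (snd z)) (is_linear_comp snd snd is_linear_snd is_linear_snd)).
  - now intros ->.
Qed.

(** * Comparison of the two metrics *)

Lemma mink_act_ideal A σ τ q :
  mink (act A (ideal σ q)) (act A (ideal τ q)) = Cnorm2 (det2 A) * (σ * τ - 1).
Proof. now rewrite mink_act, mink_ideal. Qed.

Lemma normal_mink_ideal q (w : R31) σ : normal_to q w -> mink (ideal σ q) w = 0.
Proof.
  intros [Hx Hv]; unfold ideal; rewrite mink_plus_l, mink_scal_l.
  rewrite (mink_sym _ w), (mink_sym _ w), Hx, Hv; ring.
Qed.

Lemma normal_comb q (w u : R31) (k : R) : normal_to q w -> normal_to q u ->
  normal_to q (plus w (scal k u)).
Proof.
  intros [wx wv] [ux uv]; split; rewrite mink_plus_l, mink_scal_l;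
    [ rewrite wx, ux | rewrite wv, uv ]; ring.
Qed.

(** The velocities P = w + u and M = w - u of the two null vectors can be
    prescribed independently, one for each endpoint. *)
Lemma dchartG_surj A q Z : det2 A <> RtoC 0 ->
  gap (act A (ideal 1 q)) <> 0 -> gap (act A (ideal (-1) q)) <> 0 ->
  exists w u, normal_to q w /\ normal_to q u /\ dchartG A q w u = Z.
Proof.
  intros HA Gp Gm; pose proof (Cnorm2_pos _ HA) as Hk.
  assert (H : forall σ ζ, σ * σ = 1 -> gap (act A (ideal σ q)) <> 0 ->
    exists P : R31, normal_to q P /\ dstereo (act A (ideal σ q)) (act A P) = ζ).
  { intros σ ζ Hσ G.
    destruct (dstereo_surj (act A (ideal σ q)) (act A (ideal (- σ) q)) ζ) as (Q & HQ & HQ' & E).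
    - rewrite mink_act_ideal, Hσ; ring.
    - exact G.
    - rewrite mink_act_ideal; nra.
    - destruct (act_surj A Q HA) as [P <-]; exists P; split; [ | exact E ].
      rewrite mink_act in HQ, HQ'.
      apply Rmult_integral in HQ; apply Rmult_integral in HQ'.
      destruct HQ as [h | HQ]; [ lra | ]; destruct HQ' as [h | HQ']; [ lra | ].
      unfold ideal in HQ, HQ'; rewrite mink_plus_l, mink_scal_l in HQ, HQ'.
      split; rewrite mink_sym; nra. }
  destruct (H 1 (fst Z)) as (P & NP & EP); [ lra | exact Gp | ].
  destruct (H (-1) (snd Z)) as (M & NM & EM); [ lra | exact Gm | ].
  exists (scal (/ 2) (plus P (scal 1 M))), (scal (/ 2) (plus P (scal (-1) M))).
  assert (N : forall k : R, normal_to q (scal (/ 2) (plus P (scal k M)))).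
  { intros k; destruct (normal_comb q P M k NP NM) as [h1 h2].
    split; rewrite mink_scal_l; [ rewrite h1 | rewrite h2 ]; ring. }
  split; [ apply N | split; [ apply N | ] ].
  unfold dchartG.
  rewrite (surjective_pairing Z), <- EP, <- EM; do 3 f_equal.
  all: clear; coords; vec_unfold; vec_field.
Qed.

(** [dz1dz2] pairs the velocity of one endpoint for the first vector with that
    of the other endpoint for the second.  By [Re_stereo_metric] each pairing
    equals - <P, M> up to the constant of the metric, and
    <w1 + u1, w2 - u2> + <w2 + u2, w1 - u1> = 2 (<w1, w2> - <u1, u2>). *)
Lemma Re_hol_metric_dchartG A q w1 u1 w2 u2 : det2 A <> RtoC 0 ->
  gap (act A (ideal 1 q)) <> 0 -> gap (act A (ideal (-1) q)) <> 0 ->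
  normal_to q w1 -> normal_to q u1 -> normal_to q w2 -> normal_to q u2 ->
  Re (hol_metric (stereo (act A (ideal 1 q)), stereo (act A (ideal (-1) q)))
        (dchartG A q w1 u1) (dchartG A q w2 u2)) = mink w1 w2 - mink u1 u2.
Proof.
  intros HA Gp Gm Nw1 Nu1 Nw2 Nu2; pose proof (Cnorm2_pos _ HA) as Hk.
  assert (H : forall P M : R31, normal_to q P -> normal_to q M ->
    Re (4 / ((stereo (act A (ideal 1 q)) - stereo (act A (ideal (-1) q))) *
             (stereo (act A (ideal 1 q)) - stereo (act A (ideal (-1) q)))) *
        (dstereo (act A (ideal 1 q)) (act A P) * dstereo (act A (ideal (-1) q)) (act A M)))%C
    = - mink P M).
  { intros P M NP NM.
    rewrite Re_stereo_metric; try assumption;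
      rewrite ?mink_act_ideal; rewrite ?mink_act; rewrite ?normal_mink_ideal by assumption;
      try field; lra. }
  pose proof (H _ _ (normal_comb q w1 u1 1 Nw1 Nu1) (normal_comb q w2 u2 (-1) Nw2 Nu2)) as H12.
  pose proof (H _ _ (normal_comb q w2 u2 1 Nw2 Nu2) (normal_comb q w1 u1 (-1) Nw1 Nu1)) as H21.
  unfold hol_metric, dz1dz2, dchartG; cbn [fst snd].
  match type of H12 with Re (?K * ?X)%C = _ =>
    match type of H21 with Re (?K * ?Y)%C = _ =>
      match goal with |- Re ?L = _ =>
        assert (E : L = (RtoC (- / 2) * (K * X + K * Y))%C) end end end.
  { generalize (4 / ((stereo (act A (ideal 1 q)) - stereo (act A (ideal (-1) q))) *
             (stereo (act A (ideal 1 q)) - stereo (act A (ideal (-1) q)))))%C; intros K.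
    rewrite RtoC_opp, RtoC_inv by lra; ring. }
  rewrite E; rewrite re_scal_l, re_plus, H12, H21.
  rewrite !mink_plus_l, !mink_plus_r, !mink_scal_l, !mink_scal_r.
  rewrite (mink_sym w2 w1), (mink_sym u2 u1), (mink_sym w2 u1), (mink_sym u2 w1); field.
Qed.

Theorem proposition9p2p1 (A : M2C) (hA : det2 A <> RtoC 0)
    (l : G3) (hl : chartG_dom A l) (Z1 Z2 : C * C) :
  g_metric A l Z1 Z2 = Re (hol_metric (chartG A l) Z1 Z2).
Proof.
  assert (Hgap : forall q, pG q = l ->
    gap (act A (ideal 1 q)) <> 0 /\ gap (act A (ideal (-1) q)) <> 0).
  { intros q <-; destruct hl as [Hf Hi]; split.
    - exact (proj1 (chart_dom_endpoint A _ _ q hA side_final) Hf).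
    - exact (proj1 (chart_dom_endpoint A _ _ q hA side_initial) Hi). }
  assert (Ez : forall q, pG q = l ->
    chartG A l = (stereo (act A (ideal 1 q)), stereo (act A (ideal (-1) q)))).
  { intros q Eq; destruct (Hgap q Eq) as [Gp Gm]; rewrite <- Eq; unfold chartG; f_equal.
    - exact (chart_endpoint A _ _ q hA side_final Gp).
    - exact (chart_endpoint A _ _ q hA side_initial Gm). }
  assert (Hex : exists r (q : T1H3) (w1 u1 w2 u2 : R31),
    pG q = l /\
    normal_to q w1 /\ normal_to q u1 /\ normal_to q w2 /\ normal_to q u2 /\
    is_dpG A q (lift w1 u1) Z1 /\ is_dpG A q (lift w2 u2) Z2 /\
    r = mink w1 w2 - mink u1 u2).
  { assert (Hq : exists q, pG q = l).
    { destruct l as [S [q E]]; exists q; subst S; reflexivity. }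
    destruct Hq as [q Eq]; destruct (Hgap q Eq) as [Gp Gm].
    destruct (dchartG_surj A q Z1 hA Gp Gm) as (w1 & u1 & N1 & M1 & E1).
    destruct (dchartG_surj A q Z2 hA Gp Gm) as (w2 & u2 & N2 & M2 & E2).
    exists (mink w1 w2 - mink u1 u2), q, w1, u1, w2, u2.
    rewrite <- Eq in hl.
    do 5 (split; [ assumption | ]).
    rewrite <- E1, <- E2; split; [ | split; [ | reflexivity ] ]; now apply is_dpG_dchartG. }
  apply (epsilon_spec (inhabits 0)) in Hex.
  destruct Hex as (q & w1 & u1 & w2 & u2 & Eq & N1 & M1 & N2 & M2 & D1 & D2 & E).
  unfold g_metric; rewrite E, (Ez q Eq).
  destruct (Hgap q Eq) as [Gp Gm].
  rewrite <- Eq in hl.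
  apply (is_dpG_iff A q w1 u1 Z1 hA hl N1 M1) in D1; apply (is_dpG_iff A q w2 u2 Z2 hA hl N2 M2) in D2.
  subst Z1 Z2.
  symmetry; now apply Re_hol_metric_dchartG.
Qed.
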